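(* There exists a Mycielski set $X\subset\Sigma_2$ that is invariant under the shift $\sigma$ (i.e. $\sigma(X)\subset X$) such that $X$ contains an uncountable extremal distributionally $2$-scrambled set (with respect to $\sigma$), but no triple $(x_1,x_2,x_3)\in X^3$ is $3$-scrambled (with respect to $\sigma$).
   Context: $\Sigma_2$ is the set of all infinite sequences $u=u_1u_2u_3\ldots$ with $u_i\in\{0,1\}$, with the metric $d(u,v)=\sum_{i=1}^\infty \frac{\delta(u_i,v_i)}{2^i}$, where $\delta(a,b)=0$ if $a=b$ and $\delta(a,b)=1$ if $a\ne b$. It is a compact metric space with $\operatorname{diam}\Sigma_2=1$. The shift $\sigma:\Sigma_2\to\Sigma_2$ is the continuous map $\sigma(u)_i=u_{i+1}$. A Cantor set is a nonempty, compact, totally disconnected set without isolated points. A Mycielski set is a countable union of Cantor sets. Let $n\ge2$ and $\Delta^{(n)}=\{(x_1,\dots,x_n)\in \Sigma_2^n : x_i=x_j\text{ for some }i\ne j\}$. A tuple $(x_1,\dots,x_n)$ of points of $\Sigma_2$ is $n$-scrambled if $$\liminf_{k\to\infty}\max_{1\le i<j\le n} d(\sigma^k(x_i),\sigma^k(x_j))=0 \quad\text{and}\quad \limsup_{k\to\infty}\min_{1\le i<j\le n} d(\sigma^k(x_i),\sigma^k(x_j))>0.$$ For real $\delta$ define $$\Phi_{(x_1,\dots,x_n)}(\delta)=\liminf_{m\to\infty}\frac1m\#\{0<k<m : \min_{1\le i<j\le n} d(\sigma^k(x_i),\sigma^k(x_j))<\delta\},$$ $$\Phi^*_{(x_1,\dots,x_n)}(\delta)=\limsup_{m\to\infty}\frac1m\#\{0<k<m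 : \max_{1\le i<j\le n} d(\sigma^k(x_i),\sigma^k(x_j))<\delta\}.$$ The tuple is distributionally $n$-scrambled if $\Phi^*_{(x_1,\dots,x_n)}(\delta)=1$ for all $\delta>0$ and $\Phi_{(x_1,\dots,x_n)}(\delta)=0$ for some $0<\delta\le \operatorname{diam}\Sigma_2=1$. A set $S\subset\Sigma_2$ is extremal distributionally $n$-scrambled if every tuple in $S^n\setminus\Delta^{(n)}$ is distributionally $n$-scrambled and satisfies $\Phi_{(x_1,\dots,x_n)}(\delta)=0$ for every $\delta<\operatorname{diam}\Sigma_2=1$. *)

(* Defs.v *)
From HB Require Import structures.
From mathcomp Require Import all_boot all_order all_algebra.
From mathcomp Require Import all_classical all_reals all_analysis.
Set Implicit Arguments.
Unset Strict Implicit.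
Unset Printing Implicit Defensive.
Import Order.TTheory GRing.Theory Num.Theory.
Import numFieldNormedType.Exports.
Local Open Scope classical_set_scope.
Local Open Scope ring_scope.

(* Sequences are indexed from 0: u i is the letter u_(i+1). The parameter R is
   the real line in which the metric takes its values; [nat -> bool] is wrapped
   so that its topology is the one induced by that metric. *)
Definition Sigma2 (R : realType) : Type := nat -> bool.

HB.instance Definition _ (R : realType) := Choice.copy (Sigma2 R) (nat -> bool).

Section metric.
Variable R : realType.
Implicit Types u v w : Sigma2 R.

Definition Sigma2_dist u v : R :=
  limn (series (fun i => (u i != v i)%:R / 2 ^+ i.+1 : R)).

Let term u v (i : nat) : R := (u i != v i)%:R / 2 ^+ i.+1.
Let half_ge0 (i : nat) : 0 <= (2 ^+ i.+1 : R)^-1.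
Proof. by rewrite invr_ge0 exprn_ge0. Qed.
Let term_ge0 u v i : 0 <= term u v i.
Proof. by rewrite mulr_ge0// half_ge0. Qed.
Let term_le u v i : term u v i <= (2 ^+ i.+1)^-1.
Proof. by rewrite /term; case: (_ != _); rewrite ?mul1r// mul0r half_ge0. Qed.
Let half_geo : (fun i : nat => (2 ^+ i.+1)^-1 : R) = geometric (2^-1) (2^-1).
Proof. by apply/funext => i; rewrite /= exprS invfM exprVn. Qed.
Let half_lt1 : `|2^-1 : R| < 1.
Proof. by rewrite ger0_norm ?invr_ge0// invf_lt1 ?ltr1n. Qed.
Let cvg_half : series (fun i : nat => (2 ^+ i.+1)^-1 : R) @ \oo --> (1 : R).
Proof.
rewrite half_geo; have := cvg_geometric_series (a := 2^-1 : R) half_lt1.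
suff -> : 2^-1 / (1 - 2^-1) = 1 :> R by [].
have -> : 1 - 2^-1 = 2^-1 :> R by rewrite {1}(splitr 1) mul1r addrK.
by rewrite divff// invr_eq0.
Qed.
Let cvg_term u v : cvgn (series (term u v)).
Proof.
by apply: series_le_cvg (term_ge0 u v) (half_ge0) (term_le u v) _; apply/cvg_ex; exists 1.
Qed.
Let distE u v : Sigma2_dist u v = limn (series (term u v)). Proof. by []. Qed.

Lemma Sigma2_dist_le1 u v : Sigma2_dist u v <= 1.
Proof.
rewrite distE -(cvg_lim (@norm_hausdorff _ _) cvg_half).
by apply: lim_series_le; [|apply/cvg_ex; exists 1|exact: term_le].
Qed.

Lemma Sigma2_distxx u : Sigma2_dist u u = 0.
Proof.
rewrite distE (_ : series _ = fun=> 0) ?lim_cst//.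
by apply/funext => n; rewrite /series/= big1// => i _; rewrite /term eqxx mul0r.
Qed.

Lemma Sigma2_dist_sym u v : Sigma2_dist u v = Sigma2_dist v u.
Proof.
by rewrite !distE; congr (limn (series _)); apply/funext => i; rewrite /term eq_sym.
Qed.

Lemma Sigma2_dist_positivity u v : Sigma2_dist u v = 0 -> u = v.
Proof.
move=> uv0; apply/funext => i; apply/eqP; apply/negPn/negP => uvi.
have : term u v i <= 0.
  rewrite -uv0 distE.
  have nd : nondecreasing_seq (series (term u v)).
    by apply/nondecreasing_seqP => n; rewrite seriesSr lerDl term_ge0.
  have := nondecreasing_cvgn_le nd (@cvg_term u v) i.+1.
  apply: le_trans.
  by rewrite seriesSr lerDr sumr_ge0.
by rewrite /term uvi mul1r leNgt invr_gt0 exprn_gt0.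
Qed.

Lemma Sigma2_dist_triangle v u w :
  Sigma2_dist u w <= Sigma2_dist u v + Sigma2_dist v w.
Proof.
rewrite !distE -lim_seriesD; [|exact: cvg_term..].
apply: lim_series_le; [exact: cvg_term| |].
  by apply: is_cvg_seriesD; exact: cvg_term.
move=> i; rewrite fctE /term -mulrDl ler_wpM2r// -natrD ler_nat.
by case: (u i); case: (v i); case: (w i).
Qed.

Lemma Sigma2_dist01 : Sigma2_dist (fun=> false) (fun=> true) = 1.
Proof.
rewrite -(cvg_lim (@norm_hausdorff _ _) cvg_half) distE.
by congr (limn (series _)); apply/funext => i; rewrite /term mul1r.
Qed.

End metric.

HB.instance Definition _ (R : realType) := isMetric.Build R (Sigma2 R)
  (@Sigma2_distxx R) (@Sigma2_dist_positivity R) (@Sigma2_dist_sym R)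
  (@Sigma2_dist_triangle R).

Lemma Sigma2_mdistE (R : realType) (u v : Sigma2 R) : mdist u v = Sigma2_dist u v.
Proof. by []. Qed.

Section definitions.
Variable R : realType.
Notation Sigma := (Sigma2 R).

Definition Sigma2_shift (u : Sigma) : Sigma := fun i => u i.+1.

Definition Sigma2_diam : R := sup [set mdist p.1 p.2 | p in [set: Sigma * Sigma]].

Lemma Sigma2_diamE : Sigma2_diam = 1.
Proof.
rewrite /Sigma2_diam; set A := (X in sup X).
have A1 : A 1 by exists (fun=> false, fun=> true) => //=; exact: Sigma2_dist01.
have ubA : ubound A 1 by move=> _ [p _ <-]; exact: Sigma2_dist_le1.
apply/eqP; rewrite eq_le; apply/andP; split.
- by apply: ge_sup => //; exists 1.
- by apply: ub_le_sup => //; exists 1.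
Qed.

Definition cantor_set (C : set Sigma) : Prop :=
  [/\ C !=set0, compact C, totally_disconnected C & isolated C = set0].

Definition mycielski (X : set Sigma) : Prop :=
  exists F : set (set Sigma),
    [/\ countable F, F `<=` cantor_set & X = \bigcup_(C in F) C].

Section tuples.
Variable n : nat.
Implicit Types (x : 'I_n -> Sigma) (delta : R) (k m : nat).

Definition fat_diagonal : set ('I_n -> Sigma) :=
  [set x | exists i j, i != j /\ x i = x j].

(* Distances lie in [0, Sigma2_diam], so for n >= 2 the neutral elements 0 and
   Sigma2_diam do not affect the maximum and minimum over the pairs i < j. *)
Definition max_dist x k : R :=
  \big[Num.max/0]_(i < n) \big[Num.max/0]_(j < n | (i < j)%N)
    mdist (iter k Sigma2_shift (x i)) (iter k Sigma2_shift (x j)).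

Definition min_dist x k : R :=
  \big[Num.min/Sigma2_diam]_(i < n) \big[Num.min/Sigma2_diam]_(j < n | (i < j)%N)
    mdist (iter k Sigma2_shift (x i)) (iter k Sigma2_shift (x j)).

Definition scrambled x : Prop :=
  limn_inf (max_dist x) = 0 /\ 0 < limn_sup (min_dist x).

Definition Phi x delta : R :=
  limn_inf (fun m =>
    #|[pred k : 'I_m | (0 < k)%N && (min_dist x k < delta)]|%:R / m%:R).

Definition Phi_star x delta : R :=
  limn_sup (fun m =>
    #|[pred k : 'I_m | (0 < k)%N && (max_dist x k < delta)]|%:R / m%:R).

Definition dist_scrambled x : Prop :=
  (forall delta, 0 < delta -> Phi_star x delta = 1) /\
  (exists delta, 0 < delta <= Sigma2_diam /\ Phi x delta = 0).

End tuples.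

Definition extremal_dist_scrambled (n : nat) (S : set Sigma) : Prop :=
  forall x : 'I_n -> Sigma, (forall i, S (x i)) -> ~ fat_diagonal x ->
    dist_scrambled x /\ (forall delta, delta < Sigma2_diam -> Phi x delta = 0).

End definitions.

(* Main.v *)
Require Import Defs.
From mathcomp Require Import all_boot all_order all_algebra.
From mathcomp Require Import all_classical all_reals all_analysis.
From mathcomp Require Import lra zify.
Set Implicit Arguments.
Unset Strict Implicit.
Unset Printing Implicit Defensive.
Import Order.TTheory GRing.Theory Num.Theory.
Import numFieldNormedType.Exports.

(* Perturb the Thue-Morse sequence t by adding mod 2 a sequence c which is
   constant on each block [2^2^m, 2^2^(m+1)): it is zero on the blocks with m
   even, and on the blocks with m odd it is a letter of a free parameter
   xi : nat -> bool, each letter of xi being used on infinitely many blocks.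
   X is the union of the shifts of the Cantor set of all the points t + c.

   Two points with the same shift are at the distance of their sequences c: this
   is almost 0 along the blocks with m even and almost 1 along those reading a
   letter at which the parameters differ, and each block is negligible with
   respect to the next one. Far away, a window meets at most one block with m
   odd, so that among three points with the same shift two agree on the window.
   Two points with different shifts a < b are not proximal: t_(a+i) + t_(b+i) is
   not constant on any long window, while c is constant on one half of it. *)

(** * Differences of shifts of the Thue-Morse sequence *)

Local Open Scope nat_scope.

(** This is the parity of the binary digit sum: passing from j to j + 1 clears [logn 2 j.+1]
    trailing ones and sets one zero. The recursive form exposes the increments, which are all that
    matters below. *)
Fixpoint thue_morse (i : nat) : bool :=
  if i is j.+1 then thue_morse j (+) ~~ odd (logn 2 j.+1) else false.

Lemma thue_morse_shift (a b : nat) : a < b ->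
  exists L, forall k, exists i, [/\ k <= i, i < k + L &
    thue_morse (a + i.+1) (+) thue_morse (b + i.+1) !=
    thue_morse (a + i) (+) thue_morse (b + i)].
Proof.
move=> ltab; have d_gt0 : 0 < b - a by rewrite subn_gt0.
have [r] := pfactor_coprime (isT : prime 2) d_gt0.
set m := logn 2 _; rewrite coprime2n => r_odd dE.
(* With v the 2-adic valuation, v j = m + 1 implies v (j + (b - a)) = m. *)
exists (2 ^ m.+2) => k; set L := 2 ^ m.+2.
have LE : L = 2 ^ m.+1 + 2 ^ m.+1 by rewrite /L expnS mul2n addnn.
set h := 2 ^ m.+1 in LE.
have h_gt0 : 0 < h by rewrite expn_gt0.
(* The numbers of valuation m + 1 are the odd multiples of [h]. They are [L] apart, so one of them,
   [j], satisfies a + k < j <= a + k + L. *)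
pose q := (a + k + h) %/ L; pose j := h * q.*2.+1.
have jE : j = q * L + h by rewrite /j LE; nia.
have qL : q * L <= a + k + h by exact: leq_divM.
have qL' : a + k + h < q * L + L.
  by rewrite /q -mulSnr -ltn_divLR ?LE ?addn_gt0 ?h_gt0.
exists (j - a.+1); have aj : a + (j - a.+1) = j.-1 by lia.
have bj : b + (j - a.+1) = (j + (b - a)).-1 by lia.
split; [lia|lia|].
rewrite !addnS aj bj /=.
have -> : j.-1.+1 = j by lia.
have -> : (j + (b - a)).-1.+1 = j + (b - a) by lia.
have -> : logn 2 j = m.+1.
  rewrite /j lognM// pfactorK// logn_coprime ?addn0//.
  by rewrite coprime2n /= odd_double.
have -> : logn 2 (j + (b - a)) = m.
  rewrite dE /j /h expnS -mulnA mulnCA [r * _]mulnC -mulnDr lognM//; last lia.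
  rewrite pfactorK// logn_coprime ?addn0// coprime2n oddD mul2n odd_double.
  by rewrite r_odd.
by rewrite /=; case: (thue_morse _); case: (thue_morse _); case: (odd m).
Qed.

(** * Blocks and the perturbing sequence *)

(** The places 0 and 1, which precede 2^2^0, are counted in block 0. *)
Definition block (i : nat) : nat := trunc_log 2 (trunc_log 2 i).

Lemma leq_block (i j : nat) : i <= j -> block i <= block j.
Proof. by move=> ij; do 2 apply: leq_trunc_log. Qed.

Lemma blockE (m i : nat) : 2 ^ 2 ^ m <= i < 2 ^ 2 ^ m.+1 -> block i = m.
Proof.
move=> /andP[mi im].
have i_gt0 : 0 < i by apply: leq_trans mi; rewrite expn_gt0.
apply: trunc_log_eq => //; apply/andP; split; first exact: trunc_log_max.
rewrite -(ltn_exp2l _ _ (isT : 1 < 2)).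
by apply: leq_ltn_trans im; exact: trunc_logP.
Qed.

(** Doubling k raises its logarithm from l >= 1 to l + 1 <= 2l, and doubling l raises the second
    logarithm by 1. *)
Lemma leq_blockS (k L : nat) :
  2 <= k -> L <= k -> block (k + L) <= (block k).+1.
Proof.
move=> k2 Lk; have l1 : 1 <= trunc_log 2 k by exact: trunc_log_max.
apply: (@leq_trans (block k.*2)); first by apply: leq_block; lia.
rewrite /block trunc_log2_double; last lia.
by rewrite -(trunc_log2_double l1); apply: leq_trunc_log; lia.
Qed.

(** By [leq_blockS] a window of length 2L crosses at most one block boundary, so one of its halves
    crosses none. *)
Lemma block_window (k L : nat) : 2 <= k -> L.*2 <= k ->
  exists k', [/\ k <= k', k' <= k + L &
    forall i, k' <= i <= k' + L -> block i = block k'].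
Proof.
move=> k2 Lk; have := leq_blockS k2 Lk.
have b1 : block k <= block (k + L) by apply: leq_block; lia.
have b2 : block (k + L) <= block (k + L.*2) by apply: leq_block; lia.
move=> b3; have [E|E] :
    block (k + L) = block k \/ block (k + L.*2) = block (k + L) by lia.
- exists k; split; [lia|lia|move=> i /andP[/leq_block ki /leq_block]]; lia.
- exists (k + L); split; [lia|lia|move=> i /andP[/leq_block ki]].
  by rewrite -addnA addnn => /leq_block; lia.
Qed.

(* [logn 2 m.+1] is 0 exactly for m even, and takes every positive value
   infinitely often. *)
Definition spread (xi : nat -> bool) (i : nat) : bool :=
  let n := logn 2 (block i).+1 in (0 < n) && xi n.-1.

Lemma spread_even (xi : nat -> bool) (i : nat) :
  ~~ odd (block i) -> spread xi i = false.
Proof. by move=> bi; rewrite /spread logn_coprime// coprime2n. Qed.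

(** The window meets at most two blocks, with consecutive indices. On the even one [spread]
    vanishes; the odd one, [m], reads a single letter. *)
Lemma spread_window (k L : nat) : 2 <= k -> L <= k ->
  exists n, forall xi eta : nat -> bool, xi n = eta n ->
    forall i, k <= i <= k + L -> spread xi i = spread eta i.
Proof.
move=> k2 Lk; have b3 := leq_blockS k2 Lk.
pose m := if odd (block k) then block k else (block k).+1.
exists (logn 2 m.+1).-1 => xi eta E i /andP[/leq_block ki /leq_block iL].
have [bi|bi] := boolP (odd (block i)); last by rewrite !spread_even.
have bm : block i = m; last by rewrite /spread bm E.
rewrite /m; have [E'|E'] : block i = block k \/ block i = (block k).+1 by lia.
  by rewrite -E' bi.
by move: bi; rewrite E' /= => /negbTE ->.
Qed.

(** For n = 0 this gives far blocks on which [spread] vanishes, for n > 0 far blocks which read the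
    letter n - 1. *)
Lemma block_unbounded (n N : nat) : exists2 m, N <= m & logn 2 m.+1 = n.
Proof.
exists (2 ^ n * N.*2.+1).-1; last first.
  rewrite prednK; last by rewrite muln_gt0 expn_gt0.
  rewrite lognM ?expn_gt0// pfactorK// logn_coprime ?addn0//.
  by rewrite coprime2n /= odd_double.
have : 0 < 2 ^ n by rewrite expn_gt0.
nia.
Qed.

Lemma ltn_exp2exp (m : nat) : m < 2 ^ 2 ^ m.
Proof. by apply: ltn_trans (ltn_expl m _) (ltn_expl (2 ^ m) _). Qed.

Lemma block_exp2exp (m : nat) : block (2 ^ 2 ^ m) = m.
Proof. by rewrite /block !trunc_expnK. Qed.

(** * Counting on initial segments *)

Lemma card_ord_count (P : pred nat) m :
  #|[pred k : 'I_m | P k]| = count P (iota 0 m).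
Proof.
rewrite -sum1_card -sum1_count -[in RHS](subn0 m).
by rewrite -/(index_iota 0 m) big_mkord.
Qed.

Lemma count_iota_le (P : pred nat) p m : (p <= m)%N ->
  (forall k, (p <= k < m)%N -> ~~ P k) -> (count P (iota 0 m) <= p)%N.
Proof.
move=> pm Pk; rewrite -(subnKC pm) iotaD count_cat add0n.
rewrite [X in (_ + X)%N](_ : _ = 0)%N.
  by rewrite addn0 -[leqRHS](size_iota 0); exact: count_size.
apply/eqP; rewrite -leqn0 leqNgt -has_count; apply/hasPn => k.
by rewrite mem_iota subnKC//; exact: Pk.
Qed.

Lemma count_iota_ge (P : pred nat) p m : (p <= m)%N ->
  (forall k, (p <= k < m)%N -> P k) -> (m - p <= count P (iota 0 m))%N.
Proof.
move=> pm Pk; have := count_predC P (iota 0 m); rewrite size_iota.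
have : (count (predC P) (iota 0 m) <= p)%N.
  by apply: count_iota_le => // k kpm /=; rewrite Pk.
lia.
Qed.

Local Open Scope classical_set_scope.
Local Open Scope ring_scope.

(** * Diagonal argument and pigeonhole *)

(** Cantor's argument: an enumeration of the range yields a list [h] of all binary sequences, which
    the diagonal sequence [d] escapes. *)
Lemma uncountable_range (T : Type) (f : (nat -> bool) -> T) :
  injective f -> ~ countable (range f).
Proof.
move=> injf /countable_injP[g injg].
have [h hK] : exists h : nat -> nat -> bool, forall xi, h (g (f xi)) = xi.
  have /choice[h hP] : forall n, exists xi,
      forall eta, g (f eta) = n -> eta = xi.
    move=> n; have [[xi <-]|nex] := pselect (exists xi, g (f xi) = n).
      exists xi => eta E; apply: injf; apply: injg E; apply: mem_set.
        by exists eta.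
      by exists xi.
    by exists (fun=> true) => eta E; case: nex; exists eta.
  by exists h => xi; rewrite -(hP _ xi).
pose d n := ~~ h n n.
have : h (g (f d)) (g (f d)) = ~~ h (g (f d)) (g (f d)).
  by rewrite {1}hK.
by case: (h _ _).
Qed.

Lemma three_bools (T : Type) (x : 'I_3 -> T) (f : T -> bool) :
  exists i j : 'I_3, (i < j)%N /\ f (x i) = f (x j).
Proof.
have [E|E] := eqVneq (f (x (inord 0))) (f (x (inord 1))).
  by exists (inord 0), (inord 1); rewrite !inordK.
have [E'|E'] := eqVneq (f (x (inord 0))) (f (x (inord 2))).
  by exists (inord 0), (inord 2); rewrite !inordK.
exists (inord 1), (inord 2); rewrite !inordK//; split => //.
by move: E E'; case: (f _); case: (f _); case: (f _).
Qed.

(** * Lower and upper limits of real sequences *)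

Section limits.
Variable R : realType.
Implicit Types u : nat -> R.

Lemma half_expn_lt (e : R) : 0 < e -> exists L, (2 ^+ L)^-1 < e.
Proof.
move=> e0; exists (Num.trunc e^-1).+1.
rewrite invf_plt ?posrE ?exprn_gt0//; apply: lt_trans (truncnS_gt _) _.
by rewrite -natrX ltr_nat ltn_expl.
Qed.

Lemma limn_inf_eq0 u : (forall n, 0 <= u n) ->
  (forall (e : R) N, 0 < e -> exists2 n, (N <= n)%N & u n < e) ->
  limn_inf u = 0.
Proof.
(* Every tail has infimum 0, so the limit is that of a constant sequence. *)
move=> u0 ue; rewrite /limn_inf (_ : infs u = fun=> 0) ?lim_cst//.
apply/funext => N; rewrite /infs/=.
have lb : lbound (sdrop u N) 0 by move=> _ [n _ <-].
have ne : sdrop u N !=set0 by exists (u N), N => /=.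
apply/eqP; rewrite eq_le; apply/andP; split; last exact: lb_le_inf.
apply/ler_addgt0Pr => e e0; rewrite add0r.
have [n Nn /ltW] := ue e N e0; apply: le_trans.
by apply: ge_inf; [exists 0|exists n].
Qed.

Lemma limn_sup_eq1 u : (forall n, u n <= 1) ->
  (forall (e : R) N, 0 < e -> exists2 n, (N <= n)%N & 1 - e < u n) ->
  limn_sup u = 1.
Proof.
move=> u1 ue; rewrite /limn_sup (_ : sups u = fun=> 1) ?lim_cst//.
apply/funext => N; rewrite /sups/=.
have ub : ubound (sdrop u N) 1 by move=> _ [n _ <-].
have ne : sdrop u N !=set0 by exists (u N), N => /=.
apply/eqP; rewrite eq_le; apply/andP; split; first exact: ge_sup.
apply/ler_addgt0Pr => e e0; rewrite -lerBlDr.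
have [n Nn /ltW] := ue e N e0; move/le_trans; apply.
by apply: ub_le_sup; [exists 1|exists n].
Qed.

Lemma limn_inf_ge u (e : R) N : (forall n, 0 <= u n <= 1) ->
  (forall n, (N <= n)%N -> e <= u n) -> e <= limn_inf u.
Proof.
(* The bounds on u make the tail infima converge, so that [limn] is a genuine limit. *)
move=> u01 ue; apply: limr_ge.
  apply/cvg_ex; eexists; apply: cvg_infs_sup.
    by exists 1 => _ [n _ <-]; case/andP: (u01 n).
  by exists 0 => _ [n _ <-]; case/andP: (u01 n).
exists N => // n /= Nn; apply: lb_le_inf; first by exists (u n), n => /=.
by move=> _ [m /= nm <-]; apply: ue; apply: leq_trans nm.
Qed.

Lemma limn_sup_le u (e : R) N : (forall n, 0 <= u n <= 1) ->
  (forall n, (N <= n)%N -> u n <= e) -> limn_sup u <= e.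
Proof.
move=> u01 ue; apply: limr_le.
  apply/cvg_ex; eexists; apply: cvg_sups_inf.
    by exists 1 => _ [n _ <-]; case/andP: (u01 n).
  by exists 0 => _ [n _ <-]; case/andP: (u01 n).
exists N => // n /= Nn; apply: ge_sup; first by exists (u n), n => /=.
by move=> _ [m /= nm <-]; apply: ue; apply: leq_trans nm.
Qed.

(** A block runs from b = 2^2^m to b * b, and windows of length L starting before b * b - L end
    inside it. The places before the block are a negligible part of the first b * b - L ones. *)
Lemma block_ratio_lt (e : R) L : 0 < e -> exists N, forall b, (N <= b)%N ->
  (b < b * b - L)%N /\ b%:R / (b * b - L)%:R < e.
Proof.
move=> e0; have := truncnS_gt e^-1; set T := Num.trunc _ => eT.
(* Since T + 1 > 1 / e, this inequality bounds the ratio by 1 / (T + 1) < e. *)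
exists (T + L).+3 => b Nb; have bc : (b * T.+1 <= b * b - L)%N by nia.
have c0 : (b < b * b - L)%N by nia.
split => //; rewrite ltr_pdivrMr ?ltr0n ?(leq_ltn_trans _ c0)//.
apply: (@lt_le_trans _ _ (e * (b * T.+1)%:R)).
  rewrite natrM mulrCA -[ltLHS]mulr1 ltr_pM2l ?ltr0n ?(leq_trans _ Nb)//.
  by rewrite mulrC -ltr_pdivrMr// div1r.
by rewrite ler_pM2l// ler_nat.
Qed.

Lemma freq_bounds (P : pred nat) m :
  0 <= (#|[pred k : 'I_m | P k]|%:R / m%:R : R) <= 1.
Proof.
(* For m = 0 the quotient has the default value 0. *)
rewrite divr_ge0//=; have [->|m0] := posnP m; first by rewrite invr0 mulr0.
rewrite ler_pdivrMr ?ltr0n// mul1r ler_nat.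
by rewrite -[leqRHS]card_ord max_card.
Qed.

End limits.

(** * The metric in terms of prefixes *)

Section metric.
Variable R : realType.
Implicit Types u v : Sigma2 R.

Lemma iter_shiftE k u i : iter k (@Sigma2_shift R) u i = u (k + i)%N.
Proof. by elim: k i => //= k IH i; rewrite /Sigma2_shift IH addnS. Qed.

Lemma cvg_mdist u v :
  series (fun i => (u i != v i)%:R / 2 ^+ i.+1 : R) @ \oo --> mdist u v.
Proof.
rewrite Sigma2_mdistE; apply: (@series_le_cvg _ _ (geometric 2^-1 2^-1)).
- by move=> i; rewrite mulr_ge0// invr_ge0 exprn_ge0.
- by move=> i; rewrite /geometric/= mulr_ge0// exprn_ge0.
- move=> i; rewrite /geometric/= exprVn -invfM -exprS.
  by case: (_ != _); rewrite ?mul1r// mul0r invr_ge0 exprn_ge0.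
- apply: is_cvg_geometric_series.
  by rewrite ger0_norm ?invr_ge0// invf_lt1 ?ltr1n.
Qed.

(** Splitting off the first letter reduces the distance estimates below to inductions on the prefix
    length, with no further series. *)
Lemma mdist_shift u v :
  mdist u v =
    ((u 0%N != v 0%N)%:R + mdist (Sigma2_shift u) (Sigma2_shift v)) / 2.
Proof.
have /(cvg_lim (@norm_hausdorff _ R^o)) <- := @cvg_mdist u v.
apply: (cvg_lim (@norm_hausdorff _ R^o)); rewrite -cvg_shiftS.
under eq_fun => n.
  rewrite /series/= big_nat_recl// expr1.
  under eq_bigr => i _ do rewrite exprSr invfM mulrA.
  rewrite -mulr_suml -mulrDl.
  over.
by apply: cvgMr_tmp; apply: cvgD; [exact: cvg_cst|exact: cvg_mdist].
Qed.

Lemma mdist_le_prefix L u v : (forall i, (i < L)%N -> u i = v i) ->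
  mdist u v <= (2 ^+ L)^-1.
Proof.
elim: L u v => [|L IH] u v uv.
  by rewrite invr1 Sigma2_mdistE Sigma2_dist_le1.
rewrite mdist_shift uv// eqxx add0r exprSr invfM ler_wpM2r//.
by apply: IH => i iL; exact: uv.
Qed.

Lemma mdist_ge_compl_prefix L u v : (forall i, (i < L)%N -> u i != v i) ->
  1 - (2 ^+ L)^-1 <= mdist u v.
Proof.
elim: L u v => [|L IH] u v uv; first by rewrite invr1 subrr mdist_ge0.
have := IH (Sigma2_shift u) (Sigma2_shift v) (fun i => uv i.+1).
rewrite (mdist_shift u v) (_ : (u 0%N != v 0%N)%:R = 1 :> R) ?uv// exprSr invfM.
move: (mdist _ _) ((2 ^+ L)^-1) => d e; lra.
Qed.

Lemma mdist_ge_neq i u v : u i != v i -> (2 ^+ i.+1)^-1 <= mdist u v.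
Proof.
elim: i u v => [|i IH] u v uv; rewrite mdist_shift.
  by rewrite uv expr1 -[leLHS]mul1r ler_wpM2r// lerDl mdist_ge0.
rewrite exprSr invfM ler_wpM2r//.
apply: le_trans (IH (Sigma2_shift u) (Sigma2_shift v) uv) _.
by rewrite lerDr ler0n.
Qed.

End metric.

(** * Cantor sets in the sequence space *)

Section topology.
Variable R : realType.

Lemma near_letter (u : Sigma2 R) i : \forall v \near u, v i = u i.
Proof.
apply/metricType_numDomainType.nbhs_mdistP; exists (2 ^+ i.+1)^-1.
  by rewrite /= invr_gt0 exprn_gt0.
move=> v /= uv; apply/eqP/negPn/negP; rewrite eq_sym => /mdist_ge_neq.
by rewrite leNgt uv.
Qed.

(** Closeness up to e depends on finitely many letters only, and finitely many neighbourhoods have a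
    common one. *)
Lemma Sigma2_continuous (T : topologicalType) (f : T -> Sigma2 R) :
  (forall x i, \forall y \near x, f y i = f x i) -> continuous f.
Proof.
move=> fi x; apply/metricType_numDomainType.cvgrPdist_lt => e e0.
have [L Le] := half_expn_lt e0.
have : \forall y \near x, forall i, (i < L)%N -> f y i = f x i.
  elim: L {Le} => [|L IH]; first exact: nearW.
  near=> y => i; rewrite ltnS leq_eqVlt => /predU1P[->|].
    by near: y; exact: fi.
  by move: i; near: y.
apply: filterS => y yx; apply: le_lt_trans Le.
by apply: mdist_le_prefix => i iL; rewrite yx.
Unshelve. all: by end_near. Qed.

Lemma Sigma2_zero_dimensional : zero_dimensional (Sigma2 R).
Proof.
move=> u v /eqP uv; have [i uvi] : exists i, u i <> v i.
  by apply/existsNP => uv'; apply: uv; apply/funext.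
(* Prescribing one letter defines a clopen set. *)
exists [set w : Sigma2 R | w i = u i]; split => //=; last exact/nesym.
split.
  by rewrite openE => w /= <-; exact: near_letter.
rewrite -openC openE => w /= wu; rewrite /interior/=.
by apply: filterS (near_letter w i) => z /= ->.
Qed.

Lemma totally_disconnected_Sigma2 (A : set (Sigma2 R)) : totally_disconnected A.
Proof.
move=> x Ax; apply/seteqP; split => [y [B [Bx BA cB] By]|_ ->].
  have : connected_component setT x y by exists B.
  by rewrite (zero_dimension_totally_disconnected Sigma2_zero_dimensional).
exact: connected_component_refl.
Qed.

Lemma cantor_set_range (f : cantor_space -> Sigma2 R) :
  continuous f -> injective f -> cantor_set (range f).
Proof.
move=> cf injf; split.
- by exists (f (fun=> false)), (fun=> false).
- apply: continuous_compact; last exact: cantor_space_compact.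
  exact: continuous_subspaceT.
- exact: totally_disconnected_Sigma2.
(* A neighbourhood isolating f xi would pull back, by continuity and injectivity, to one isolating
   xi in the perfect Cantor space. *)
- rewrite -subset0 => _ [/set_mem[xi _ <-] [V Vx VA]].
  have [_ lim] := cantor_perfect.
  have : limit_point [set: cantor_space] xi by rewrite lim.
  move=> /(_ _ (cf xi V Vx))[eta [/eqP neq _ Veta]]; apply: neq; apply: injf.
  have : (V `&` range f) (f eta) by split => //; exists eta.
  by rewrite VA.
Qed.

End topology.

(** * Extremal distances within a tuple *)

Section tuples.
Variable R : realType.

Section any_size.
Variables (n : nat) (x : 'I_n -> Sigma2 R) (k : nat).
Notation sh := (iter k (@Sigma2_shift R)).
Notation D i j := (mdist (sh (x i)) (sh (x j))).

Lemma min_dist_le (i j : 'I_n) : (i < j)%N -> min_dist x k <= D i j.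
Proof.
move=> ij; apply: le_trans (bigmin_le _ i _) _.
exact: (bigmin_le_cond _ (fun j => D i j) ij).
Qed.

Lemma max_dist_ge (i j : 'I_n) : (i < j)%N -> D i j <= max_dist x k.
Proof.
move=> ij; apply: le_trans (le_bigmax _ _ i).
exact: (le_bigmax_cond _ (fun j => D i j) ij).
Qed.

Lemma min_dist_bounds : 0 <= min_dist x k <= 1.
Proof.
rewrite /min_dist Sigma2_diamE; apply/andP; split; last exact: bigmin_le_id.
by apply: le_bigmin => // i _; apply: le_bigmin => // j _; exact: mdist_ge0.
Qed.

Lemma max_dist_bounds : 0 <= max_dist x k <= 1.
Proof.
rewrite /max_dist; apply/andP; split; first exact: bigmax_ge_id.
apply: bigmax_le => // i _; apply: bigmax_le => // j _.
by rewrite Sigma2_mdistE Sigma2_dist_le1.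
Qed.

End any_size.

Lemma pair_dist (x : 'I_2 -> Sigma2 R) k :
  let sh := iter k (@Sigma2_shift R) in
  let d := mdist (sh (x ord0)) (sh (x ord_max)) in
  min_dist x k = d /\ max_dist x k = d.
Proof.
move=> sh d; have pairE (i j : 'I_2) : (i < j)%N -> i = ord0 /\ j = ord_max.
  by case: i => -[|[|//]] ?; case: j => -[|[|//]] ? // _; split; apply/val_inj.
split; apply/eqP; rewrite eq_le.
- rewrite min_dist_le//=; apply: le_bigmin => [|i _].
    by rewrite /d Sigma2_diamE Sigma2_mdistE Sigma2_dist_le1.
  apply: le_bigmin => [|j /pairE[-> ->]//].
  by rewrite /d Sigma2_diamE Sigma2_mdistE Sigma2_dist_le1.
- rewrite max_dist_ge//= andbT; apply: bigmax_le => [|i _].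
    exact: mdist_ge0.
  by apply: bigmax_le => [|j /pairE[-> ->]//]; exact: mdist_ge0.
Qed.

End tuples.

(** * The shifted points and their orbits *)

Section construction.
Variable R : realType.
Implicit Types xi eta : nat -> bool.

Definition point xi : Sigma2 R := fun i => thue_morse i (+) spread xi i.

Definition shift_point k xi : Sigma2 R := iter k (@Sigma2_shift R) (point xi).

Lemma shift_pointE k xi i :
  shift_point k xi i = thue_morse (k + i) (+) spread xi (k + i).
Proof. by rewrite /shift_point iter_shiftE. Qed.

Lemma shift_point_continuous k :
  continuous (shift_point k : cantor_space -> Sigma2 R).
Proof.
apply: Sigma2_continuous => xi i.
set n := (logn 2 (block (k + i)).+1).-1.
have near_n : \forall eta \near (xi : cantor_space), eta n = xi n.
  exact: (@proj_continuous _ (fun _ : nat => bool) n xi _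
    (discrete_set1 (xi n))).
by apply: filterS near_n => eta E; rewrite !shift_pointE /spread -/n E.
Qed.

(** Each letter of the parameter is read arbitrarily far out, hence also beyond the k places removed
    by the shift. *)
Lemma shift_point_inj k : injective (shift_point k).
Proof.
move=> xi eta E; apply/funext => n.
have [m km mn] := block_unbounded n.+1 k.
have ki : (k <= 2 ^ 2 ^ m)%N := leq_trans km (ltnW (ltn_exp2exp m)).
have := congr1 (fun u : Sigma2 R => u (2 ^ 2 ^ m - k)%N) E.
by rewrite !shift_pointE subnKC// /spread block_exp2exp mn /= => /addbI.
Qed.

Lemma shift_point_apart a b : (a < b)%N -> exists2 e : R, 0 < e &
  exists K, forall k, (K <= k)%N -> forall xi eta,
    e <= mdist (shift_point (k + a) xi) (shift_point (k + b) eta).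
Proof.
move=> ab; have [L tmL] := thue_morse_shift ab.
(* [M] leaves room for the offset b and for the places i and i + 1 of a change, so that all letters
   compared lie in one block. *)
pose M := (b + L).+1; exists (2 ^+ (M.*2).+1)^-1.
  by rewrite invr_gt0 exprn_gt0.
exists (maxn 2 M.*2) => k; rewrite geq_max => /andP[k2 Mk] xi eta.
have [k' [kk' k'k bk']] := block_window k2 Mk.
have [i [k'i ik' tmi]] := tmL k'.
have sp zeta j : (k' <= j <= k' + M)%N -> spread zeta j = spread zeta k'.
  by move=> jk; rewrite /spread bk'.
(* Agreement at both i and i + 1 would give the Thue-Morse sum the same value, that of the constant
   [spread] terms, at both places. *)
have [j [ij jM neq]] : exists j, [/\ (k <= j)%N, (j < k + M.*2)%N &
    thue_morse (a + j) (+) spread xi k' != thue_morse (b + j) (+) spread eta k'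
    /\ (j = i \/ j = i.+1)].
  have [E|ne] := eqVneq (thue_morse (a + i) (+) spread xi k')
                       (thue_morse (b + i) (+) spread eta k').
    exists i.+1; split; [lia|lia|split; last by right].
    apply: contra tmi => /eqP E'; apply/eqP.
    move: E E'; case: (spread xi _); case: (spread eta _);
      by do 4 case: (thue_morse _).
  by exists i; split; [lia|lia|split; last by left].
case: neq => neq ji.
have := @mdist_ge_neq R (j - k)
  (shift_point (k + a) xi) (shift_point (k + b) eta).
have jk c : (k + c + (j - k) = c + j)%N by lia.
rewrite !shift_pointE !jk !sp; [|lia|lia] => /(_ neq); apply: le_trans.
by rewrite lef_pV2 ?posrE ?exprn_gt0// ler_weXn2l// ?ler1n; lia.
Qed.

Lemma iter_shift_point k a xi :
  iter k (@Sigma2_shift R) (shift_point a xi) = shift_point (k + a) xi.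
Proof. by rewrite /shift_point iterD. Qed.

Lemma shift_point_triple a L k (xi : 'I_3 -> nat -> bool) :
  (2 <= k)%N -> (L <= k)%N ->
  exists i j : 'I_3, (i < j)%N /\
    mdist (shift_point (k + a) (xi i)) (shift_point (k + a) (xi j))
      <= (2 ^+ L)^-1.
Proof.
move=> k2 Lk; have [||n spn] := @spread_window (k + a) L; [lia|lia|].
have [i [j [ij E]]] := three_bools xi (fun z => z n).
exists i, j; split => //; apply: mdist_le_prefix => l lL.
by rewrite !shift_pointE (spn _ _ E)//; lia.
Qed.

Lemma not_scrambled3 (x : 'I_3 -> Sigma2 R) :
  (forall i, (\bigcup_a range (shift_point a)) (x i)) -> ~ scrambled x.
Proof.
move=> Xx; have /choice[axi xE] : forall i, exists p : nat * (nat -> bool),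
    x i = shift_point p.1 p.2.
  by move=> i; have [a _ [xi _ <-]] := Xx i; exists (a, xi).
(* Two different shifts keep the maximum away from 0, against the lower limit; a common shift makes
   the minimum tend to 0, against the upper limit. *)
case; have [[i [j [ij aij]]]|aE] := pselect (exists i j : 'I_3,
    (i < j)%N /\ (axi i).1 != (axi j).1).
  have [e e0 [K eK]] : exists2 e : R, 0 < e & exists K, forall k, (K <= k)%N ->
      e <= max_dist x k.
    case: (ltngtP (axi i).1 (axi j).1) aij => // aij _.
    - have [e e0 [K eK]] := shift_point_apart aij.
      exists e => //; exists K => k Kk; apply: le_trans (max_dist_ge _ _ ij).
      by rewrite !xE !iter_shift_point; exact: eK.
    - have [e e0 [K eK]] := shift_point_apart aij.
      exists e => //; exists K => k Kk; apply: le_trans (max_dist_ge _ _ ij).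
      by rewrite metric_sym !xE !iter_shift_point; exact: eK.
  move=> inf0 _; have := limn_inf_ge (max_dist_bounds x) eK.
  by rewrite inf0 leNgt e0.
move=> _ /half_expn_lt[L]; apply/negP; rewrite -leNgt.
apply: (@limn_sup_le _ _ _ (maxn 2 L)); first exact: min_dist_bounds.
move=> k; rewrite geq_max => /andP[k2 Lk].
have [i [j [ij dij]]] :=
  shift_point_triple (axi ord0).1 (fun i => (axi i).2) k2 Lk.
apply: le_trans (min_dist_le _ _ ij) _.
have aE0 l : (axi l).1 = (axi ord0).1.
  apply/eqP; rewrite eq_sym; apply/negPn/negP => al; apply: aE; exists ord0, l.
  split=> //; rewrite lt0n; apply: contra al => /eqP l0.
  by rewrite (_ : l = ord0)//; exact: val_inj.
by rewrite !xE !iter_shift_point (aE0 i) (aE0 j).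
Qed.

(** Take a block reading a letter where the parameters differ: the Thue-Morse terms coincide there,
    so the windows inside it are complementary. *)
Lemma shift_point_far L N xi eta : xi <> eta -> exists2 b, (N <= b)%N &
  forall k, (b <= k < b * b - L)%N ->
    1 - (2 ^+ L)^-1 <= mdist (shift_point k xi) (shift_point k eta).
Proof.
move=> neq; have [n xin] : exists n, xi n <> eta n.
  by apply/existsNP => E; apply: neq; apply/funext.
have [m Nm mn] := block_unbounded n.+1 N.
exists (2 ^ 2 ^ m)%N => [|k /andP[bk kb]].
  exact: leq_trans Nm (ltnW (ltn_exp2exp m)).
apply: mdist_ge_compl_prefix => i iL; rewrite !shift_pointE.
have spE zeta : spread zeta (k + i) = zeta n.
  rewrite /spread (@blockE m) ?mn//; apply/andP; split; first lia.
  by rewrite expnS mulnC expnM expnS expn1; lia.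
by rewrite !spE; apply/eqP => /addbI.
Qed.

(** Here the block index is even, so both points follow the Thue-Morse sequence. *)
Lemma shift_point_close L N xi eta : exists2 b, (N <= b)%N &
  forall k, (b <= k < b * b - L)%N ->
    mdist (shift_point k xi) (shift_point k eta) <= (2 ^+ L)^-1.
Proof.
have [m Nm mn] := block_unbounded 0 N.
exists (2 ^ 2 ^ m)%N => [|k /andP[bk kb]].
  exact: leq_trans Nm (ltnW (ltn_exp2exp m)).
apply: mdist_le_prefix => i iL; rewrite !shift_pointE.
have spE zeta : spread zeta (k + i) = false.
  rewrite /spread (@blockE m) ?mn//; apply/andP; split; first lia.
  by rewrite expnS mulnC expnM expnS expn1; lia.
by rewrite !spE.
Qed.

Lemma extremal_points : extremal_dist_scrambled 2 (range (shift_point 0%N)).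
Proof.
move=> x Sx xdiag; have [xi _ x0] := Sx ord0; have [eta _ x1] := Sx ord_max.
have neq : xi <> eta.
  move=> E; apply: xdiag; exists ord0, ord_max; split => //.
  by rewrite -x0 -x1 E.
have minE k : min_dist x k = mdist (shift_point k xi) (shift_point k eta).
  by have [-> _] := pair_dist x k; rewrite -x0 -x1 !iter_shift_point addn0.
have maxE k : max_dist x k = mdist (shift_point k xi) (shift_point k eta).
  by have [_ ->] := pair_dist x k; rewrite -x0 -x1 !iter_shift_point addn0.
have Phi0 delta : delta < Sigma2_diam R -> Phi x delta = 0.
  rewrite Sigma2_diamE -subr_gt0 => /half_expn_lt[L Ld].
  apply: limn_inf_eq0 => [m|e N e0].
    by have /andP[] :=
      freq_bounds R (fun k => (0 < k)%N && (min_dist x k < delta)) m.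
  have [N' ratio] := block_ratio_lt L e0.
  have [b Nb far] := shift_point_far L (maxn N N') neq.
  move: Nb; rewrite geq_max => /andP[Nb /ratio[bc be]].
  (* Among the first b * b - L places, only those before b can have a distance below delta, as 2^-L
     < 1 - delta. *)
  exists (b * b - L)%N; first exact: leq_trans Nb (ltnW bc).
  apply: le_lt_trans be; rewrite ler_wpM2r ?invr_ge0// ler_nat.
  rewrite (card_ord_count (fun k => (0 < k)%N && (min_dist x k < delta))).
  apply: count_iota_le => [|k kb]; first exact: ltnW.
  rewrite negb_and -leNgt minE; apply/orP; right.
  by apply: le_trans (far _ kb); rewrite lerBrDr -lerBrDl ltW.
split => //; split => [delta /half_expn_lt[L Ld]|]; last first.
  exists 2^-1; rewrite Phi0 ?Sigma2_diamE ?invf_lt1 ?ltr1n//.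
  by rewrite invr_gt0 ltr0n invf_le1 ?ler1n.
apply: limn_sup_eq1 => [m|e N e0].
  by have /andP[] :=
      freq_bounds R (fun k => (0 < k)%N && (max_dist x k < delta)) m.
have [N' ratio] := block_ratio_lt L e0.
(* The successor of N' forces b > 0, so the places k >= b meet the condition 0 < k of the count. *)
have [b Nb close] := shift_point_close L (maxn N N'.+1) xi eta.
move: Nb; rewrite geq_max => /andP[Nb N'b]; have [bc be] := ratio b (ltnW N'b).
exists (b * b - L)%N; first exact: leq_trans Nb (ltnW bc).
rewrite ltrBlDr -ltrBlDl; apply: le_lt_trans be.
have c0 : (b * b - L)%:R != 0 :> R.
  by rewrite pnatr_eq0 -lt0n (leq_ltn_trans _ bc).
rewrite -[X in X - _](divff c0) -mulrBl ler_wpM2r ?invr_ge0//.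
rewrite lerBlDr -lerBlDl -natrB ?(ltnW bc)// ler_nat.
rewrite (card_ord_count (fun k => (0 < k)%N && (max_dist x k < delta))).
apply: count_iota_ge => [|k /andP[bk kb]]; first exact: ltnW.
rewrite maxE (leq_trans (leq_trans (ltn0Sn _) N'b) bk)/=.
by apply: le_lt_trans Ld; apply: close; rewrite bk.
Qed.

End construction.

Theorem theorem2 (R : realType) :
  exists X : set (Sigma2 R),
    [/\ mycielski X,
        @Sigma2_shift R @` X `<=` X,
        (exists S : set (Sigma2 R),
          [/\ S `<=` X, ~ countable S & extremal_dist_scrambled 2 S]) &
        forall x : 'I_3 -> Sigma2 R, (forall i, X (x i)) -> ~ scrambled x].
Proof.
exists (\bigcup_a range (shift_point R a)); split.
- exists (range (fun a => range (shift_point R a))); split.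
  + by apply: card_image_le.
  + move=> _ [a _ <-]; apply: cantor_set_range; last exact: shift_point_inj.
    exact: shift_point_continuous.
  + apply/seteqP; split => [u [a _ au]|u [_ [a _ <-] au]]; last by exists a.
    by exists (range (shift_point R a)) => //; exists a.
- by move=> _ [_ [a _ [xi _ <-]] <-]; exists a.+1 => //; exists xi.
- exists (range (shift_point R 0)); split.
  + by move=> u u0; exists 0%N.
  + by apply: uncountable_range; exact: shift_point_inj.
  + exact: extremal_points.
- exact: not_scrambled3.
Qed.
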